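(* Let $f,g:\mathbb{R}^n\to\mathbb{R}\cup\{+\infty\}$ be closed convex proper functions such that there exist $x^\star,u^\star\in\mathbb{R}^n$ with $0\in\partial f(x^\star)+u^\star$ and $0\in\partial g^*(u^\star)-x^\star$. Let $\alpha>0$, let $x^0,u^0\in\mathbb{R}^n$, and let $\{(x^k,u^k)\}_{k\ge 0}$ be generated by $$x^{k+1}=\mathrm{prox}_{\alpha f}\big(x^k-\alpha u^k\big),\qquad u^{k+1}=\mathrm{prox}_{\alpha^{-1}g^*}\big(u^k+\tfrac1\alpha(2x^{k+1}-x^k)\big),\qquad k=0,1,2,\dots$$ For each integer $K\ge 1$ put $\bar x^K=\frac1K\sum_{k=1}^K x^k$ and $\bar u^K=\frac1K\sum_{k=1}^K u^k$. Then for all integers $K\ge1$, all $x\in\mathrm{dom}\, f$ and all $u\in\mathrm{dom}\, g^*$, $$\mathcal{L}(\bar x^K,u)-\mathcal{L}(x,\bar u^K)\le\frac{1}{\alpha(K+1)}\left(\|x^0-x\|^2+\alpha^2\|u^0-u\|^2\right).$$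
   Context: $\langle\cdot,\cdot\rangle$ and $\|\cdot\|$ are the standard inner product and Euclidean norm on $\mathbb{R}^n$. $g^*(y)=\sup_x\{\langle y,x\rangle-g(x)\}$ is the Fenchel conjugate, $\partial$ the convex subdifferential, and $\mathrm{prox}_\varphi(x)=\arg\min_{y}\{\varphi(y)+\frac12\|y-x\|^2\}$. The Lagrangian is $\mathcal{L}(x,u)=f(x)+\langle u,x\rangle-g^*(u)$. The iteration is the swapped Douglas--Rachford splitting algorithm (variant DRS-$fg$) for minimizing $f+g$. *)

(* Defs.v *)
From HB Require Import structures.
From mathcomp Require Import all_boot all_order all_algebra.
From mathcomp Require Import all_classical all_reals all_analysis.

Set Implicit Arguments.
Unset Strict Implicit.
Unset Printing Implicit Defensive.

Import Order.TTheory GRing.Theory Num.Theory.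
Import numFieldNormedType.Exports.

Local Open Scope classical_set_scope.
Local Open Scope ring_scope.

(* R^n is 'rV[R]_n for R : realType, and functions into R \cup {+oo} have
   codomain \bar R, the value -oo being excluded by [proper_fun]. *)

Section Euclidean.
Variables (R : realType) (n : nat).
Implicit Types x y : 'rV[R]_n.

Definition dotv x y : R := \sum_(i < n) x 0 i * y 0 i.

(* The library norm `|x| on 'rV[R]_n is the sup norm, hence this one. *)
Definition enorm x : R := Num.sqrt (dotv x x).

End Euclidean.

Section ConvexFunctions.
Variables (R : realType) (n : nat).
Implicit Types (f g phi : 'rV[R]_n -> \bar R) (x y u : 'rV[R]_n).

Definition edom f : set 'rV[R]_n := [set x | (f x < +oo)%E].

Definition proper_fun f : Prop :=
  (forall x, (-oo < f x)%E) /\ edom f !=set0.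

Definition convex_fun f : Prop :=
  forall x y (t : R), 0 < t < 1 ->
    (f (t *: x + (1 - t) *: y)%R <= t%:E * f x + (1 - t)%:E * f y)%E.

Definition epigraph f : set ('rV[R]_n * R) :=
  [set p | (f p.1 <= (p.2)%:E)%E].

Definition closed_fun f : Prop := closed (epigraph f).

Definition ccp f : Prop := [/\ closed_fun f, convex_fun f & proper_fun f].

Definition conjugate g y : \bar R :=
  ereal_sup [set ((dotv y x)%:E - g x)%E | x in [set: 'rV[R]_n]].

(* For proper f this set is empty whenever f x = +oo. *)
Definition subdifferential f x : set 'rV[R]_n :=
  [set v | forall y, (f x + (dotv v (y - x)%R)%:E <= f y)%E].

Definition argmin f : set 'rV[R]_n := [set p | forall y, (f p <= f y)%E].

(* The default value 0 of [xget] is never used for closed convex proper phi: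
   the minimizer then exists and is unique. *)
Definition prox phi x : 'rV[R]_n :=
  xget 0 (argmin (fun y => (phi y + (2^-1 * enorm (y - x)%R ^+ 2)%:E)%E)).

(* On dom f x R^n and on R^n x dom g^* no sum below is of the form oo - oo. *)
Definition lagrangian f g x u : \bar R :=
  (f x + (dotv u x)%:E - conjugate g u)%E.

End ConvexFunctions.

(* The mean of s 1, ..., s K; the initial point s 0 is left out. *)
Definition ergodic_mean (R : realType) (n : nat) (s : nat -> 'rV[R]_n)
    (K : nat) : 'rV[R]_n :=
  K%:R^-1 *: \sum_(1 <= k < K.+1) s k.

(* Main.v *)
Require Import Defs.
From HB Require Import structures.
From mathcomp Require Import all_boot all_order all_algebra.
From mathcomp Require Import all_classical all_reals all_analysis.
From mathcomp Require Import ring lra.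

Set Implicit Arguments.
Unset Strict Implicit.
Unset Printing Implicit Defensive.

Import Order.TTheory GRing.Theory Num.Theory.
Import numFieldNormedType.Exports.

Local Open Scope classical_set_scope.
Local Open Scope ring_scope.

(** The change of variable w k = x k - alpha u k turns the iteration into a
    proximal-point scheme.  By the optimality conditions of the two prox steps
    ([prox_scale_subgradient]) and after cancellation of the bilinear terms,
    alpha times the gap L(x k.+1, u') - L(x', u k.+1) is at most
    <w k - w k.+1, w k.+1 - c>, where c = x' - alpha u'.  This product equals
      (|w k - c|^2 - |w k.+1 - c|^2 - |w k - w k.+1|^2) / 2.

    Dropping the last square and telescoping gives |w 0 - c|^2 / (2 K) for the
    mean of the gaps.  Keeping it gives the denominator K + 1: the vector
    w 0 - c is the sum of the K steps w k - w k.+1 and of w K - c, so the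
    squared norms of these K + 1 vectors add up to at least
    |w 0 - c|^2 / (K + 1), and what remains of |w 0 - c|^2 / 2 is its fraction
    K / (K + 1) ([proximal_path_sum_le]).  Jensen's inequality for f and for
    g^* ([jensen_ergodic_mean]) passes from the mean of the gaps to the gap at
    the means, and |a - b|^2 <= 2 (|a|^2 + |b|^2) with a = x 0 - x' and
    b = alpha (u 0 - u') separates the primal and dual distances.

    The optimality conditions require the prox steps to be attained.  The
    saddle point provides a subgradient of f and one of g^*, hence affine
    minorants; adding a quadratic to a function that has one makes its sublevel
    sets compact, and a minimizer exists ([argmin_prox_neq0]). *)

(** * Bilinearity of the inner product *)

Section InnerProduct.
Variables (R : realType) (n : nat).
Implicit Types x y z : 'rV[R]_n.

Lemma dotvC x y : dotv x y = dotv y x.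
Proof. by apply: eq_bigr => i _; rewrite mulrC. Qed.

Lemma dotvDl x y z : dotv (x + y) z = dotv x z + dotv y z.
Proof. by rewrite -big_split; apply: eq_bigr => i _; rewrite mxE mulrDl. Qed.

Lemma dotvZl a x z : dotv (a *: x) z = a * dotv x z.
Proof.
by rewrite /dotv mulr_sumr; apply: eq_bigr => i _; rewrite mxE mulrA.
Qed.

Lemma dotvNl x z : dotv (- x) z = - dotv x z.
Proof. by rewrite -scaleN1r dotvZl mulN1r. Qed.

Lemma dotvDr x y z : dotv z (x + y) = dotv z x + dotv z y.
Proof. by rewrite dotvC dotvDl !(dotvC z). Qed.

Lemma dotvZr a x z : dotv z (a *: x) = a * dotv z x.
Proof. by rewrite dotvC dotvZl dotvC. Qed.

Lemma dotvNr x z : dotv z (- x) = - dotv z x.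
Proof. by rewrite dotvC dotvNl dotvC. Qed.

Lemma dotv0r z : dotv z 0 = 0.
Proof. by rewrite -[X in dotv _ X](scale0r 0) dotvZr mul0r. Qed.

Definition dotv_bilinear :=
  (dotvDl, dotvDr, dotvNl, dotvNr, dotvZl, dotvZr).

Lemma dotv_ge0 x : 0 <= dotv x x.
Proof. by apply: sumr_ge0 => i _; rewrite -expr2 sqr_ge0. Qed.

Lemma sqr_enorm x : enorm x ^+ 2 = dotv x x.
Proof. by rewrite sqr_sqrtr ?dotv_ge0. Qed.

Lemma sqr_coord_le x i : x 0 i ^+ 2 <= dotv x x.
Proof.
rewrite /dotv (bigD1 i) //= -expr2 lerDl sumr_ge0 // => j _.
by rewrite -expr2 sqr_ge0.
Qed.

Lemma dotv_sumr (I : Type) (r : seq I) (P : pred I) (s : I -> 'rV[R]_n) z :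
  dotv z (\sum_(k <- r | P k) s k) = \sum_(k <- r | P k) dotv z (s k).
Proof.
elim/big_rec2: _ => [|k y1 y2 _ <-]; last exact: dotvDr.
exact: dotv0r.
Qed.

Lemma dotv_ergodic_mean (s : nat -> 'rV[R]_n) K z :
  dotv z (ergodic_mean s K) = K%:R^-1 * \sum_(1 <= k < K.+1) dotv z (s k).
Proof. by rewrite dotvZr dotv_sumr. Qed.

(** * Sums along a proximal path *)

(** Each right-hand side is half of
    |w k - c|^2 - |w k.+1 - c|^2 - |w k - w k.+1|^2.
    For any fixed vector b the last square is at least
    2 <b, w k - w k.+1> - |b|^2, which telescopes along the path; likewise
    |w K - c|^2 >= 2 <b, w K - c> - |b|^2.  The vector b = (w 0 - c) / (K + 1)
    is the common value of the K + 1 displacements in the extremal case of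
    equally spaced points from w 0 to c. *)
Lemma proximal_path_sum_le (w : nat -> 'rV[R]_n) (c : 'rV[R]_n)
    (gap : nat -> R) (K : nat) :
  (forall k, gap k.+1 <= dotv (w k - w k.+1) (w k.+1 - c)) ->
  \sum_(1 <= k < K.+1) gap k <=
    K%:R / (2 * K.+1%:R) * dotv (w 0%N - c) (w 0%N - c).
Proof.
move=> gap_le.
have K1_gt0 : 0 < K.+1%:R :> R by rewrite ltr0n.
have partial_sum b m : \sum_(1 <= k < m.+1) gap k <=
    2^-1 * (dotv (w 0%N - c) (w 0%N - c) - dotv (w m - c) (w m - c))
    - dotv b (w 0%N - w m) + m%:R / 2 * dotv b b.
  elim: m => [|m IHm].
    by rewrite big_geq // !subrr dotv0r; lra.
  rewrite big_nat_recr //= -(natr1 m).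
  have := gap_le m; have := dotv_ge0 (w m - w m.+1 - b); move: IHm.
  rewrite !dotv_bilinear (dotvC (w m.+1) (w m)) !(dotvC _ b).
  rewrite !(dotvC c); lra.
apply: le_trans (partial_sum (K.+1%:R^-1 *: (w 0%N - c)) K) _.
have := dotv_ge0 (w K - c - K.+1%:R^-1 *: (w 0%N - c)).
(* Only a = w 0 - c and e = w K - c remain, with t = 1 / (k + 1). *)
have -> : w 0%N - w K = (w 0%N - c) - (w K - c) by rewrite opprB addrA subrK.
move: (w 0%N - c) (w K - c) => a e.
rewrite !dotv_bilinear (dotvC a e) -(natr1 K) => e_sqr.
rewrite -(natr1 K) in K1_gt0.
move: (dotv a a) (dotv e e) (dotv e a) e_sqr K1_gt0 => A E' D.
move: K%:R => k; set t := (k + 1)^-1 => e_sqr k_gt0.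
have kt : k * t = 1 - t.
  by rewrite /t; field; rewrite gt_eqF.
have -> : k / (2 * (k + 1)) = (1 - t) / 2 by rewrite -kt invfM mulrCA mulrC.
have -> : k / 2 * (t * (t * A)) = (1 - t) * (t * A) / 2 by rewrite -kt; ring.
lra.
Qed.

End InnerProduct.

(** * Existence and optimality of proximal points *)

Section ProximalPoint.
Variables (R : realType) (n : nat).
Implicit Types (f : 'rV[R]_n -> \bar R) (x y z v : 'rV[R]_n).

Lemma continuous_dotv (T : topologicalType) (s1 s2 : T -> 'rV[R]_n) :
  continuous s1 -> continuous s2 -> continuous (fun a => dotv (s1 a) (s2 a)).
Proof.
move=> s1_cont s2_cont a; rewrite /dotv.
apply: cvg_big => [|i _].
  exact: add_continuous.
apply: cvgM.
  exact: (continuous_comp (s1_cont a) (@coord_continuous _ _ _ 0 i _)).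
exact: (continuous_comp (s2_cont a) (@coord_continuous _ _ _ 0 i _)).
Qed.

Lemma subdifferential_fin_num f x v :
  proper_fun f -> subdifferential f x v -> f x \is a fin_num.
Proof.
move=> [f_gtNy [y fy_lty]] /(_ y) fx_le.
rewrite fin_numE -ltNye f_gtNy; apply: contraTneq fy_lty => fxE.
by move: fx_le; rewrite fxE addye // leye_eq => /eqP ->.
Qed.

Lemma convex_fun_le f x y (a b t : R) : convex_fun f -> 0 < t < 1 ->
  (f x <= a%:E)%E -> (f y <= b%:E)%E ->
  (f (t *: x + (1 - t) *: y)%R <= (t * a + (1 - t) * b)%:E)%E.
Proof.
move=> f_convex t01 fx fy; apply: le_trans (f_convex x y t t01) _.
have [t_gt0 t_lt1] := andP t01.
rewrite (EFinD (t * a)) !EFinM leeD // lee_pmul2l // lte_fin //.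
by rewrite subr_gt0.
Qed.

(** A subgradient gives an affine minorant of f, which bounds the heights in
    the part of the epigraph below a level of the regularized objective, and
    the quadratic term bounds the points.  This closed set is then compact, and
    the continuous function r + |y - x|^2 / 2 of a pair (y, r) attains its
    minimum there. *)
Lemma argmin_prox_neq0 f x : closed_fun f -> proper_fun f ->
  (exists p v, subdifferential f p v) ->
  argmin (fun y => (f y + (2^-1 * enorm (y - x)%R ^+ 2)%:E)%E) !=set0.
Proof.
move=> f_closed f_proper [p [v v_sub]].
have fp_fin := subdifferential_fin_num f_proper v_sub.
pose q y := 2^-1 * dotv (y - x) (y - x).
pose minor y := fine (f p) + dotv v (y - p).
have f_ge_minor y r : (f y <= r%:E)%E -> minor y <= r.
  move=> fy_le; rewrite -lee_fin; apply: le_trans fy_le.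
  by rewrite EFinD fineK //; exact: v_sub.
pose M := fine (f p) + q p.
pose C := epigraph f `&` [set yr | yr.2 + q yr.1 <= M].
have q_cont : continuous (fun yr : 'rV[R]_n * R => q yr.1).
  have sub_cont : continuous (fun yr : 'rV[R]_n * R => yr.1 - x).
    by move=> a; apply: cvgB; [exact: cvg_fst | exact: cvg_cst].
  move=> yr; apply: cvgM; first exact: cvg_cst.
  exact: (continuous_dotv sub_cont sub_cont).
have obj_cont : continuous (fun yr : 'rV[R]_n * R => yr.2 + q yr.1).
  by move=> yr; apply: cvgD; [exact: cvg_snd | exact: q_cont].
have C_closed : closed C.
  apply: closedI => //.
  exact: (preimage_closed (fun a _ => obj_cont a) (@closed_le _ M)).
(* Young's inequality |<v, d>| <= |d|^2 / 4 + |v|^2 with d = y - x: half of the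
   quadratic term absorbs the slope of the minorant. *)
pose B := M - fine (f p) - dotv v (x - p) + dotv v v.
have C_sqr y r : C (y, r) -> 4^-1 * dotv (y - x) (y - x) <= B.
  move=> [/f_ge_minor y_ge /= y_le]; rewrite /B.
  have := dotv_ge0 (2^-1 *: (y - x) + v).
  rewrite /minor /= in y_ge; rewrite /q in y_le.
  rewrite (_ : y - p = (y - x) + (x - p)) in y_ge; last first.
    by rewrite addrA subrK.
  move: (y - x) (x - p) y_le y_ge => d e.
  by rewrite !dotv_bilinear (dotvC v d); lra.
have B_ge0 : 0 <= B.
  apply: le_trans (C_sqr p (fine (f p)) _); first by rewrite mulr_ge0 ?dotv_ge0.
  by split; rewrite /epigraph /= ?fineK.
(* s ^ 2 <= 4 B implies |s| <= 4 B + 1, which avoids square roots. *)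
pose b := 4 * B + 1.
have C_compact : compact C.
  pose I (i : 'I_n) : set R := `[x 0 i - b, x 0 i + b]%classic.
  pose J : set R := `[fine (f p) + dotv v (x - p) - B - dotv v v, M]%classic.
  have I_compact i : compact (I i) by exact: segment_compact.
  have J_compact : compact J by exact: segment_compact.
  apply: subclosed_compact C_closed
    (compact_setX (rV_compact I_compact) J_compact) _ => -[y r] Cyr.
  have dd_le := C_sqr _ _ Cyr; case: Cyr => /f_ge_minor /= y_ge y_le.
  split => [i|]; rewrite ?/I ?/J /= in_itv /=.
    have := sqr_coord_le (y - x) i; rewrite !mxE /b => y_sqr.
    by apply/andP; split; nra.
  rewrite /minor /= (_ : y - p = (y - x) + (x - p)) in y_ge; last first.
    by rewrite addrA subrK.
  have := dotv_ge0 (2^-1 *: (y - x) + v); have := dotv_ge0 (y - x).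
  rewrite /q in y_le; move: (y - x) (x - p) y_le y_ge dd_le => d e.
  rewrite !dotv_bilinear (dotvC v d) => *; apply/andP; split; lra.
have C_neq0 : C !=set0.
  by exists (p, fine (f p)); split; rewrite /epigraph /= ?fineK.
have [[c r]] :=
  compact_EVT_min C_neq0 C_compact (continuous_subspaceT obj_cont).
rewrite inE => -[/= fc_le c_le] c_min.
exists c => y; rewrite !sqr_enorm.
have : (f c + (q c)%:E <= (r + q c)%:E)%E by rewrite EFinD leeD2r.
move=> /le_trans; apply.
case fyE: (f y) => [s||]; last by have := f_proper.1 y; rewrite fyE.
  rewrite -EFinD lee_fin -/(q y).
  have [y_le|/ltW y_gt] := leP (s + q y) M; last exact: le_trans y_gt.
  by apply: (c_min (y, s)); rewrite inE; split => //; rewrite /epigraph /= fyE.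
by rewrite leey.
Qed.

Lemma prox_subdifferential f x : ccp f ->
  (exists p v, subdifferential f p v) ->
  subdifferential f (prox f x) (x - prox f x).
Proof.
move=> [f_closed f_convex f_proper] f_sub y.
have : argmin (fun y => (f y + (2^-1 * enorm (y - x)%R ^+ 2)%:E)%E) (prox f x).
  have [p p_min] := argmin_prox_neq0 x f_closed f_proper f_sub.
  exact: xgetI p_min.
move: (prox f x) => p p_min.
have [f_gtNy [z fz_lty]] := f_proper.
have fp_fin : f p \is a fin_num.
  rewrite fin_numE -ltNye f_gtNy -ltey /= ltNge leye_eq; apply/negP => /eqP fpE.
  have := p_min z; rewrite fpE addye // leye_eq.
  by move: fz_lty (f_gtNy z); rewrite /edom /=; case: (f z).
case fyE: (f y) => [s||]; last by have := f_gtNy y; rewrite fyE.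
  rewrite -(fineK fp_fin) -EFinD lee_fin.
  set a := fine (f p); set l := dotv _ _.
  (* Minimality of p against the point p + t (y - p), divided by t. *)
  have slope t : 0 < t < 1 -> a + l <= s + t / 2 * dotv (y - p) (y - p).
    move=> /[dup] t01 /andP[t_gt0 t_lt1].
    have := p_min (t *: y + (1 - t) *: p).
    have fy_le : (f y <= s%:E)%E by rewrite fyE.
    have fp_le : (f p <= a%:E)%E by rewrite fineK.
    move=> /le_trans /(_ (leeD2r _ (convex_fun_le f_convex t01 fy_le fp_le))).
    rewrite -(fineK fp_fin) -!EFinD lee_fin !sqr_enorm -/a /l.
    have -> : t *: y + (1 - t) *: p - x = t *: (y - p) - (x - p).
      by rewrite scalerBl scale1r scalerBr opprB !addrA addrAC.
    rewrite -(opprB x p).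
    move: (y - p) (x - p) => d e; rewrite !dotv_bilinear (dotvC d e) => le_t.
    rewrite -subr_ge0 -(pmulr_rge0 _ t_gt0); lra.
  apply/ler_addgt0Pr => e e_gt0.
  (* A t in ]0, 1[ that makes the error term t D / 2 at most e. *)
  pose D := dotv (y - p) (y - p); have D_ge0 : 0 <= D := dotv_ge0 _.
  pose t := e / (e + D + 1).
  have t_gt0 : 0 < t by rewrite divr_gt0 //; lra.
  have t_lt1 : t < 1 by rewrite ltr_pdivrMr; lra.
  apply: le_trans (slope t _) _; first by rewrite t_gt0.
  rewrite lerD2l -/D.
  have : t * (e + D + 1) = e by rewrite divfK // gt_eqF //; lra.
  nra.
by rewrite leey.
Qed.

Lemma mulEFin_gtNy (a : R) (e : \bar R) :
  0 < a -> (-oo < e -> -oo < a%:E * e)%E.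
Proof.
by move=> a_gt0; case: e => [r||] //= _;
  rewrite -?EFinM ?ltNyr ?gt0_muley ?lte_fin.
Qed.

Lemma subdifferential_scale (a : R) f x v : 0 < a ->
  subdifferential f x v ->
  subdifferential (fun y => a%:E * f y)%E x (a *: v).
Proof.
move=> a_gt0 v_sub y; rewrite dotvZl EFinM -muleDr ?fin_num_adde_defl //.
by rewrite lee_pmul2l // lte_fin.
Qed.

(** The iteration takes proximal points of multiples of f and of g^*. *)
Lemma ccp_scale (a : R) f : 0 < a -> ccp f -> ccp (fun y => a%:E * f y)%E.
Proof.
move=> a_gt0 [f_closed f_convex [f_gtNy [z fz_lty]]].
have aE_gt0 : (0 < a%:E)%E by rewrite lte_fin.
split.
- rewrite /closed_fun.
  have -> : epigraph (fun y => a%:E * f y)%E =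
      (fun yr : 'rV[R]_n * R => (yr.1, a^-1 * yr.2)) @^-1` epigraph f.
    apply/funext => -[y r]; rewrite /epigraph /preimage /mkset /=.
    rewrite -[(f y <= _)%E](lee_pmul2l _ aE_gt0) //.
    by rewrite -EFinM mulrA mulfV ?gt_eqF // mul1r.
  have scale_cont : continuous (fun yr : 'rV[R]_n * R => (yr.1, a^-1 * yr.2)).
    move=> yr; have fst_cvg : yr'.1 @[yr' --> yr] --> yr.1 by exact: cvg_fst.
    have snd_cvg : a^-1 * yr'.2 @[yr' --> yr] --> a^-1 * yr.2.
      by apply: cvgM; [exact: cvg_cst | exact: cvg_snd].
    exact: cvg_pair fst_cvg snd_cvg.
  exact: (preimage_closed (fun yr _ => scale_cont yr) f_closed).
- move=> x y t t01; have [t_gt0 t_lt1] := andP t01.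
  rewrite !(muleCA _ a%:E) -muleDr //; first by rewrite lee_pmul2l ?f_convex.
  by rewrite ltninfty_adde_def // inE mulEFin_gtNy ?subr_gt0.
- split=> [x|]; first exact: mulEFin_gtNy.
  exists z; move: fz_lty (f_gtNy z); rewrite /edom /=.
  by case: (f z) => [r||]; rewrite ?ltxx // -EFinM !ltry.
Qed.

(** The inclusion x - p in a times the subdifferential of f at p, tested at
    the points where f is finite so that it becomes an inequality between
    reals. *)
Lemma prox_scale_subgradient (a : R) f x : 0 < a -> ccp f ->
  (exists p v, subdifferential f p v) ->
  let p := prox (fun y => a%:E * f y)%E x in
  f p \is a fin_num /\
  forall y, f y \is a fin_num ->
    a * (fine (f p) - fine (f y)) <= dotv (x - p) (p - y).
Proof.
move=> a_gt0 f_ccp [q [v v_sub]] p.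
have af_ccp := ccp_scale a_gt0 f_ccp; have [_ _ af_proper] := af_ccp.
have p_sub : subdifferential (fun y => a%:E * f y)%E p (x - p).
  apply: prox_subdifferential => //; exists q, (a *: v).
  exact: subdifferential_scale.
have fp_fin : f p \is a fin_num.
  have := subdifferential_fin_num af_proper p_sub.
  by case: (f p) => //=; rewrite ?gt0_muley ?gt0_muleNy ?lte_fin.
split=> // y fy_fin; have := p_sub y.
rewrite -(fineK fp_fin) -(fineK fy_fin) -!EFinM -EFinD lee_fin.
by rewrite -(opprB p y) dotvNr; lra.
Qed.

(** * Conjugate functions *)

Lemma fenchel_young f x y :
  ((dotv y x)%:E - f x <= conjugate f y)%E.
Proof. by apply: ereal_sup_ubound; exists x. Qed.

(** The epigraph of a supremum of affine functions is an intersection of closed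
    half-spaces, of the whole space (where f is +oo) and of the empty set
    (where f is -oo). *)
Lemma closed_conjugate f : closed_fun (conjugate f).
Proof.
rewrite /closed_fun.
have -> : epigraph (conjugate f) = \bigcap_(x in [set: 'rV[R]_n])
    [set yr : 'rV[R]_n * R | ((dotv yr.1 x)%:E - f x <= yr.2%:E)%E].
  apply/seteqP; split=> [[y r] yr_epi x _|[y r] yr_epi] /=.
    by apply: le_trans yr_epi; exact: fenchel_young.
  by apply/ereal_supP => _ [x _ <-]; exact: yr_epi.
apply: closed_bigI => x _; case: (f x) => [r||].
- have affine_cont :
      continuous (fun yr : 'rV[R]_n * R => dotv yr.1 x - yr.2).
    have cst_cont : continuous (fun _ : 'rV[R]_n * R => x).
      by move=> yr; exact: cvg_cst.
    move=> yr; apply: cvgB; last exact: cvg_snd.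
    by apply: (continuous_dotv _ cst_cont) => ?; exact: cvg_fst.
  have -> : [set yr : 'rV[R]_n * R | ((dotv yr.1 x)%:E - r%:E <= yr.2%:E)%E] =
      (fun yr => dotv yr.1 x - yr.2) @^-1` [set s | s <= r].
    apply/funext => yr; rewrite /preimage /mkset /= -EFinB lee_fin.
    by rewrite lerBlDr lerBlDl addrC.
  exact: (preimage_closed (fun a _ => affine_cont a) (@closed_le _ r)).
- have -> : [set yr : 'rV[R]_n * R | ((dotv yr.1 x)%:E - +oo <= yr.2%:E)%E] =
      setT.
    by apply/seteqP; split=> // yr _ /=; rewrite addeNy leNye.
  exact: closedT.
- have -> : [set yr : 'rV[R]_n * R | ((dotv yr.1 x)%:E - -oo <= yr.2%:E)%E] =
      set0.
    by apply/seteqP; split=> // yr /=; rewrite addey // leye_eq.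
  exact: closed0.
Qed.

Lemma convex_conjugate f : proper_fun f -> convex_fun (conjugate f).
Proof.
move=> [f_gtNy _] y z t /andP[t_gt0 t_lt1].
apply/ereal_supP => _ [x _ <-].
have := fenchel_young f x y; have := fenchel_young f x z.
case: (f x) (f_gtNy x) => [r||]; rewrite ?ltxx // => _; last first.
  by move=> *; rewrite addeNy leNye.
rewrite -!EFinB => z_le y_le.
have -> : dotv (t *: y + (1 - t) *: z) x - r =
    t * (dotv y x - r) + (1 - t) * (dotv z x - r).
  by rewrite !dotv_bilinear; ring.
rewrite (EFinD (t * _)) !EFinM leeD // lee_pmul2l // lte_fin //.
by rewrite subr_gt0.
Qed.

Lemma ccp_conjugate f :
  proper_fun f -> edom (conjugate f) !=set0 -> ccp (conjugate f).
Proof.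
move=> f_proper conj_dom; split; first exact: closed_conjugate.
  exact: convex_conjugate.
split=> // y; have [f_gtNy [x fx_lty]] := f_proper.
apply: lt_le_trans (fenchel_young f x y).
move: fx_lty (f_gtNy x); rewrite /edom /=.
by case: (f x) => [r||]; rewrite ?ltxx // -EFinB !ltNyr.
Qed.

(** * Convexity along ergodic means *)

Lemma jensen_ergodic_mean f (s : nat -> 'rV[R]_n) (r : nat -> R) K :
  convex_fun f -> (forall k, (f (s k.+1) <= (r k.+1)%:E)%E) -> (0 < K)%N ->
  (f (ergodic_mean s K) <= (K%:R^-1 * \sum_(1 <= k < K.+1) r k)%:E)%E.
Proof.
move=> f_convex fs_le; elim: K => // -[_ _|K IHK _].
  by rewrite /ergodic_mean !big_nat1 invr1 scale1r mul1r.
(* The new mean is t times the previous one plus 1 - t times the last point. *)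
pose t : R := K.+1%:R / K.+2%:R.
have K1_gt0 : 0 < K.+1%:R :> R by rewrite ltr0n.
have K2_gt0 : 0 < K.+2%:R :> R by rewrite ltr0n.
have t01 : 0 < t < 1.
  by rewrite /t divr_gt0 //= ltr_pdivrMr // mul1r ltr_nat ltnSn.
have tC : 1 - t = K.+2%:R^-1.
  rewrite /t -[X in X - _](mulfV (lt0r_neq0 K2_gt0)) -mulrBl.
  by rewrite -natrB // subSnn mul1r.
have tV : t * K.+1%:R^-1 = K.+2%:R^-1.
  by rewrite /t mulrAC mulfV ?gt_eqF // mul1r.
have := convex_fun_le f_convex t01 (IHK isT) (fs_le K.+1).
by rewrite /ergodic_mean scalerA mulrA tV tC -scalerDr -mulrDr -!big_nat_recr.
Qed.

End ProximalPoint.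

(** * The convergence rate *)

Theorem theorem3p6 (R : realType) (n : nat) (f g : 'rV[R]_n -> \bar R)
  (f_ccp : ccp f) (g_ccp : ccp g)
  (saddle : exists xs us : 'rV[R]_n,
     0 \in [set v + us | v in subdifferential f xs] /\
     0 \in [set v - xs | v in subdifferential (conjugate g) us])
  (alpha : R) (alpha_gt0 : 0 < alpha)
  (x u : nat -> 'rV[R]_n)
  (x_step : forall k, x k.+1 =
     prox (fun y => alpha%:E * f y)%E (x k - alpha *: u k))
  (u_step : forall k, u k.+1 =
     prox (fun y => (alpha^-1)%:E * conjugate g y)%E
          (u k + alpha^-1 *: (2 *: x k.+1 - x k)))
  (K : nat) (K_ge1 : (1 <= K)%N)
  (x' : 'rV[R]_n) (x'_dom : x' \in edom f)
  (u' : 'rV[R]_n) (u'_dom : u' \in edom (conjugate g)) :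
  (lagrangian f g (ergodic_mean x K) u' - lagrangian f g x' (ergodic_mean u K)
   <= ((alpha * K.+1%:R)^-1 *
       (enorm (x 0%N - x') ^+ 2 + alpha ^+ 2 * enorm (u 0%N - u') ^+ 2))%:E)%E.
Proof.
rewrite !inE in x'_dom u'_dom.
have [_ _ g_proper] := g_ccp.
have gs_ccp : ccp (conjugate g) by apply: ccp_conjugate => //; exists u'.
have [f_sub gs_sub] : (exists p v, subdifferential f p v) /\
    (exists p v, subdifferential (conjugate g) p v).
  have [xs [us []]] := saddle; rewrite !inE => -[v v_sub _] [v' v'_sub _].
  by split; [exists xs, v | exists us, v'].
have [[_ f_convex [f_gtNy _]] [_ gs_convex [gs_gtNy _]]] := (f_ccp, gs_ccp).
have fx'_fin : f x' \is a fin_num by rewrite fin_numE -ltNye f_gtNy -ltey.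
have gsu'_fin : conjugate g u' \is a fin_num.
  by rewrite fin_numE -ltNye gs_gtNy -ltey.
pose w k := x k - alpha *: u k.
pose F k := fine (f (x k)); pose G k := fine (conjugate g (u k)).
have x_opt k : f (x k.+1) \is a fin_num /\
    alpha * (F k.+1 - fine (f x')) <= dotv (w k - x k.+1) (x k.+1 - x').
  rewrite /F x_step.
  by have [? fp_le] := prox_scale_subgradient (w k) alpha_gt0 f_ccp f_sub; auto.
(* The inequality for u k.+1 is multiplied by alpha ^ 2. *)
have u_opt k : conjugate g (u k.+1) \is a fin_num /\
    alpha * (G k.+1 - fine (conjugate g u')) <=
    dotv (2 *: x k.+1 - alpha *: u k.+1 - w k) (alpha *: (u k.+1 - u')).
  have ialpha_gt0 : 0 < alpha^-1 by rewrite invr_gt0.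
  set z := u k + alpha^-1 *: (2 *: x k.+1 - x k).
  have := prox_scale_subgradient z ialpha_gt0 gs_ccp gs_sub.
  rewrite -u_step => -[gsu_fin /(_ u' gsu'_fin) gsu_le]; split=> //.
  have -> : 2 *: x k.+1 - alpha *: u k.+1 - w k = alpha *: (z - u k.+1).
    by apply/rowP => i; rewrite /w /z !mxE; field; rewrite gt_eqF.
  by rewrite dotvZl dotvZr ler_pM2l // -ler_pdivrMl.
pose gap k := F k + dotv u' (x k) - fine (conjugate g u')
              - (fine (f x') + dotv x' (u k) - G k).
have gap_le k : alpha * gap k.+1 <=
    dotv (w k - w k.+1) (w k.+1 - (x' - alpha *: u')).
  have [_] := x_opt k; have [_] := u_opt k; rewrite /gap /w.
  move: (F k.+1) (G k.+1) (fine _) (fine _) => a b a' b'.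
  rewrite !dotv_bilinear !(dotvC _ (x k.+1)) !(dotvC _ (u k.+1)).
  rewrite !(dotvC _ x') !(dotvC _ u'); lra.
have := proximal_path_sum_le (gap := fun k => alpha * gap k) K gap_le.
rewrite -mulr_sumr => gap_sum_le.
(* The bilinear terms of the gap are affine in each iterate, so passing to the
   means only takes Jensen's inequality for f and for g^*.  The bounds also show
   that both functions are finite at the means. *)
have Fmean_le : (f (ergodic_mean x K) <=
    (K%:R^-1 * \sum_(1 <= k < K.+1) F k)%:E)%E.
  by apply: jensen_ergodic_mean => // k; rewrite fineK //; case: (x_opt k).
have Gmean_le : (conjugate g (ergodic_mean u K) <=
    (K%:R^-1 * \sum_(1 <= k < K.+1) G k)%:E)%E.
  by apply: jensen_ergodic_mean => // k; rewrite fineK //; case: (u_opt k).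
have Fmean_fin : f (ergodic_mean x K) \is a fin_num.
  by rewrite fin_numE -ltNye f_gtNy -ltey (le_lt_trans Fmean_le) ?ltry.
have Gmean_fin : conjugate g (ergodic_mean u K) \is a fin_num.
  by rewrite fin_numE -ltNye gs_gtNy -ltey (le_lt_trans Gmean_le) ?ltry.
rewrite /lagrangian !sqr_enorm; move: Fmean_le Gmean_le.
rewrite -(fineK fx'_fin) -(fineK gsu'_fin).
rewrite -(fineK Fmean_fin) -(fineK Gmean_fin).
rewrite -!(EFinD, EFinB) !lee_fin (dotvC _ x') !dotv_ergodic_mean.
have K_gt0 : 0 < K%:R :> R by rewrite ltr0n.
have K1_gt0 : 0 < K.+1%:R :> R by rewrite ltr0n.
set dist := dotv _ _ + _ => Fmean_le Gmean_le.
have dist_ge : dotv (w 0%N - (x' - alpha *: u')) (w 0%N - (x' - alpha *: u'))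
    <= 2 * dist.
  have -> : w 0%N - (x' - alpha *: u') = x 0%N - x' - alpha *: (u 0%N - u').
    by apply/rowP => i; rewrite /w !mxE; ring.
  have := dotv_ge0 (x 0%N - x' + alpha *: (u 0%N - u')).
  rewrite /dist; move: (x 0%N - x') (u 0%N - u') => a b.
  rewrite !dotv_bilinear (dotvC b a); lra.
(* Jensen: the gap at the means is at most the mean of the gaps. *)
apply: (@le_trans _ _ (K%:R^-1 * \sum_(1 <= k < K.+1) gap k)).
  rewrite /gap !(big_split, sumrN) /= !sumr_const_nat subn1 /=.
  rewrite -(mulr_natl (fine (f x'))) -(mulr_natl (fine (conjugate g u'))).
  rewrite !(mulrDr, mulrN) !(mulKf (lt0r_neq0 K_gt0)); lra.
rewrite -(ler_pM2l alpha_gt0) mulrCA.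
apply: (@le_trans _ _ (K%:R^-1 * (K%:R / (2 * K.+1%:R) * (2 * dist)))).
  rewrite ler_pM2l ?invr_gt0 //; apply: le_trans gap_sum_le _.
  by rewrite ler_wpM2l // divr_ge0 // mulr_ge0.
rewrite le_eqVlt; apply/orP; left; apply/eqP; field.
by rewrite !gt_eqF //.
Qed.
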